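(* For every $1\le p<\infty$, the space $L^p[0,1]$ of (equivalence classes under almost everywhere equality of) Lebesgue measurable functions $f:[0,1]\to\mathbb{C}$ with $\|f\|_p=\left(\int_{[0,1]}|f(x)|^p\,\mathrm{d}x\right)^{1/p}<\infty$ is a Banach space with uniform multiplicity infinity of infinite index.
   Context: $\mathcal{B}(X)$ is the set of bounded linear operators on a complex Banach space $X$. A system of matrix units of $\mathcal{B}(X)$ is a family $\{u_{j,k}\}_{j,k=0}^{\infty}\subset\mathcal{B}(X)$ such that (a) $\sup\{\|u_{j,k}\|:j,k\ge 0\}<\infty$; (b) $u_{j,k}u_{l,m}=\delta_{kl}u_{j,m}$ for all $j,k,l,m$ (Kronecker delta); (c) $x=\sum_{k=0}^{\infty}u_{k,k}x$ for every $x\in X$, with convergence in norm. An infinite-dimensional Banach space $X$ has uniform multiplicity infinity of infinite index if there is a system of matrix units $\{u_{j,k}\}_{j,k=0}^\infty$ of $\mathcal{B}(X)$ with $\dim\operatorname{Ran}u_{0,0}=\infty$. *)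

(* Defs.v *)
From HB Require Import structures.
From mathcomp Require Import all_boot all_order all_algebra.
From mathcomp Require Import generic_quotient complex.
From mathcomp Require Import all_classical all_reals all_analysis.
From mathcomp Require Import measurable_realfun.

Set Implicit Arguments.
Unset Strict Implicit.
Unset Printing Implicit Defensive.

Import Order.TTheory GRing.Theory Num.Theory.
Import numFieldNormedType.Exports.
Import ComplexField.Normc.

Local Open Scope classical_set_scope.
Local Open Scope ring_scope.
Local Open Scope complex_scope.

Lemma normc_Re (R : rcfType) (z : R[i]) : normc z = complex.Re `|z|.
Proof. by case: z. Qed.

Lemma normcC (R : rcfType) (z : R[i]) : (normc z)%:C = `|z|.
Proof. by case: z. Qed.

Lemma normc_ge0 (R : rcfType) (z : R[i]) : 0 <= normc z.
Proof. by case: z => a b; exact: sqrtr_ge0. Qed.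

Lemma ler_normcD (R : rcfType) (z w : R[i]) :
  normc (z + w) <= normc z + normc w.
Proof. by rewrite -lecR rmorphD/= !normcC ler_normD. Qed.

Section ComplexLfun.
Context d (T : measurableType d) (R : realType).
Variables (mu : {measure set T -> \bar R}) (D : set T) (p : R).

(* Functions on [D] are represented by total functions on [T] whose values
   off [D] are irrelevant. *)
Definition cmeasurable_fun (f : T -> R[i]) : Prop :=
  measurable_fun D (fun x => complex.Re (f x)) /\
  measurable_fun D (fun x => complex.Im (f x)).

Definition cLnorm (f : T -> R[i]) : \bar R :=
  ((\int[mu]_(x in D) (normc (f x) `^ p)%:E) `^ p^-1)%E.

Definition cLfun : {pred T -> R[i]} :=
  mem [set f : T -> R[i] | cmeasurable_fun f /\ (cLnorm f < +oo)%E].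

Lemma cLfunP f :
  reflect (cmeasurable_fun f /\ (cLnorm f < +oo)%E) (f \in cLfun).
Proof. by apply: (iffP idP); rewrite inE. Qed.

Lemma measurable_normc f : measurable D -> cmeasurable_fun f ->
  measurable_fun D (fun x => normc (f x)).
Proof.
move=> mD [mr mi].
rewrite (_ : (fun x => _) = (fun x =>
    (complex.Re (f x) ^+ 2 + complex.Im (f x) ^+ 2) `^ 2^-1)); last first.
  by apply/funext => x; case: (f x) => ? ?;
    rewrite powR12_sqrt// addr_ge0 ?sqr_ge0.
apply: (@measurableT_comp _ _ _ _ _ _ (@powR R ^~ 2^-1)) => //.
by apply: measurable_funD; exact: measurable_funX.
Qed.

Lemma cmeasurable_funD f g : cmeasurable_fun f -> cmeasurable_fun g ->
  cmeasurable_fun (f \+ g).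
Proof.
move=> [fr fi] [gr gi]; split.
  rewrite (_ : (fun x => _) =
      (fun x => complex.Re (f x)) \+ (fun x => complex.Re (g x))).
    exact: measurable_funD.
  by apply/funext => x /=; case: (f x) (g x) => ? ? [].
rewrite (_ : (fun x => _) =
    (fun x => complex.Im (f x)) \+ (fun x => complex.Im (g x))).
  exact: measurable_funD.
by apply/funext => x /=; case: (f x) (g x) => ? ? [].
Qed.

Lemma cmeasurable_funZ f (a : R[i]) : cmeasurable_fun f ->
  cmeasurable_fun (fun x => a * f x).
Proof.
move=> [fr fi]; split.
  rewrite (_ : (fun x => _) = (fun x => complex.Re a * complex.Re (f x)) \-
      (fun x => complex.Im a * complex.Im (f x))).
    by apply: measurable_funB; exact: measurable_funM.
  by apply/funext => x /=; case: (a) (f x) => ? ? [].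
rewrite (_ : (fun x => _) = (fun x => complex.Re a * complex.Im (f x)) \+
    (fun x => complex.Im a * complex.Re (f x))).
  by apply: measurable_funD; exact: measurable_funM.
by apply/funext => x /=; case: (a) (f x) => ? ? [].
Qed.

Let q (f : T -> R[i]) := (fun x => normc (f x)) \_ D.

Let measurable_q f : measurable D -> cmeasurable_fun f ->
  measurable_fun setT (q f).
Proof.
move=> mD mf; apply/(measurable_restrictT _ _).1 => //.
exact: measurable_normc.
Qed.

Let cLnormE f : 1 <= p -> cLnorm f = 'N[mu]_p%:E[EFin \o q f]%E.
Proof.
move=> p1; 
rewrite /cLnorm unlock /=.
apply: (congr1 (fun y => (y `^ p^-1)%E)).
rewrite integral_mkcond; apply: eq_integral => x _.
rewrite /q !patchE; case: ifP => _.
  by rewrite ger0_norm ?normc_ge0.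
by rewrite normr0 powR0// gt_eqF// (lt_le_trans ltr01).
Qed.

Lemma cLnorm_ge0 f : (0 <= cLnorm f)%E.
Proof. exact: poweR_ge0. Qed.

Lemma cLnormD f g : measurable D -> 1 <= p ->
  cmeasurable_fun f -> cmeasurable_fun g ->
  (cLnorm (f \+ g)%R <= cLnorm f + cLnorm g)%E.
Proof.
move=> mD p1 mf mg; rewrite !cLnormE//.
have mq := measurable_q mD.
apply: le_trans (minkowski_EFin mu (mq _ mf) (mq _ mg) p1).
rewrite unlock/=; apply: gt0_ler_poweR.
- by rewrite invr_ge0 (le_trans ler01).
- by rewrite in_itv/= leey integral_ge0// => x _; rewrite poweR_ge0.
- by rewrite in_itv/= leey integral_ge0// => x _; rewrite poweR_ge0.
have mfg := cmeasurable_funD mf mg.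
apply: ge0_le_integral => //.
- apply/measurable_EFinP.
  apply: (@measurableT_comp _ _ _ _ _ _ (@powR R ^~ p)) => //.
  by apply: measurableT_comp => //; exact: mq.
- apply/measurable_EFinP.
  apply: (@measurableT_comp _ _ _ _ _ _ (@powR R ^~ p)) => //.
  by apply: measurableT_comp => //; apply: measurable_funD; exact: mq.
move=> x _; rewrite lee_fin ge0_ler_powR ?nnegrE ?(le_trans ler01 p1)//.
rewrite /q !patchE; case: ifP => _; last by rewrite addr0.
by rewrite !ger0_norm ?addr_ge0 ?normc_ge0 ?ler_normcD.
Qed.

Lemma cLnormZ f (a : R[i]) : measurable D -> 1 <= p -> cmeasurable_fun f ->
  cLnorm (fun x => a * f x) = ((normc a)%:E * cLnorm f)%E.
Proof.
move=> mD p1 mf; rewrite /cLnorm.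
have p0 : p != 0 by rewrite gt_eqF// (lt_le_trans ltr01).
under eq_integral do rewrite normcM powRM ?normc_ge0// EFinM.
rewrite ge0_integralZl_EFin ?powR_ge0//.
- rewrite poweRM ?lee_fin ?powR_ge0 ?integral_ge0//.
    by rewrite poweR_EFin -powRrM mulfV// powRr1 ?normc_ge0.
  by move=> x _; rewrite lee_fin powR_ge0.
- by move=> x _; rewrite lee_fin powR_ge0.
- apply/measurable_EFinP.
  apply: (@measurableT_comp _ _ _ _ _ _ (@powR R ^~ p)) => //.
  exact: measurable_normc.
Qed.

Lemma cLnorm_ae f g : measurable D ->
  cmeasurable_fun f -> cmeasurable_fun g ->
  f = g %[ae mu in D] -> cLnorm f = cLnorm g.
Proof.
move=> mD mf mg fg; 
rewrite /cLnorm.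
apply: (congr1 (fun y => (y `^ p^-1)%E)).
apply: ae_eq_integral => //.
- apply/measurable_EFinP.
  apply: (@measurableT_comp _ _ _ _ _ _ (@powR R ^~ p)) => //.
  exact: measurable_normc.
- apply/measurable_EFinP.
  apply: (@measurableT_comp _ _ _ _ _ _ (@powR R ^~ p)) => //.
  exact: measurable_normc.
by apply: filterS fg => x /[apply] ->.
Qed.

Lemma cLnorm_eq0 f : measurable D -> 1 <= p -> cmeasurable_fun f ->
  cLnorm f = 0%E -> f = (fun=> 0) %[ae mu in D].
Proof.
move=> mD p1 mf; rewrite cLnormE// => /Lnorm_eq0_eq0.
have mq : measurable_fun setT (EFin \o q f).
  by apply/measurable_EFinP; exact: measurable_q.
move=> /(_ mq); rewrite lte_fin (lt_le_trans ltr01)// => /(_ isT).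
apply: filterS => x /(_ Logic.I) /= [+] Dx.
by rewrite /q patchE mem_set//; exact: eq0_normc.
Qed.

Lemma cLfun_submod_closed : measurable D -> 1 <= p -> submod_closed cLfun.
Proof.
move=> mD p1; split.
  apply/cLfunP; split; first by split; exact: measurable_cst.
  have := @cLnormZ (fun=> 0) 0 mD p1; rewrite normc0 mul0e.
  rewrite (_ : (fun=> 0 * 0) = 0); last by apply/funext => x; rewrite mul0r.
  by move=> ->//; split; exact: measurable_cst.
move=> a f g /cLfunP[mf nf] /cLfunP[mg ng]; apply/cLfunP.
have maf := cmeasurable_funZ a mf.
rewrite (_ : a *: f + g = (fun x => a * f x) \+ g); last exact/funext.
split; first exact: cmeasurable_funD maf mg.
apply: (le_lt_trans (cLnormD mD p1 maf mg)).
apply: lte_add_pinfty; last exact: ng.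
rewrite (cLnormZ a mD p1 mf).
by apply: lte_mul_pinfty; [rewrite lee_fin normc_ge0|by []|exact: nf].
Qed.

End ComplexLfun.
Section ComplexLspace.
Context d (T : measurableType d) (R : realType).
Variables (mu : {measure set T -> \bar R}) (D : set T) (mD : measurable D).
Variables (p : R) (p1 : 1 <= p).

(* [mD] and [p1] are parameters of the type because its vector space
   structure depends on them. *)
Record cLfunType (mD : measurable D) (p1 : 1 <= p) := CLfun {
  cLfun_val :> T -> R[i];
  cLfun_valP : cLfun_val \in cLfun mu D p }.

Local Notation cLfunT := (cLfunType mD p1).

HB.instance Definition _ := [isSub for @cLfun_val mD p1].
HB.instance Definition _ := [Choice of cLfunT by <:].

#[local] HB.instance Definition _ :=
  GRing.isSubmodClosed.Build R[i] (T -> R[i]) (cLfun mu D p)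
    (cLfun_submod_closed mu mD p1).

HB.instance Definition _ := [SubChoice_isSubLmodule of cLfunT by <:].

Lemma cLfun_valN (f : cLfunT) x : (- f) x = - f x.
Proof. reflexivity. Qed.

Lemma cLfun_valD (f g : cLfunT) x : (f + g) x = f x + g x.
Proof. reflexivity. Qed.

Lemma cLfun_valZ (a : R[i]) (f : cLfunT) x : (a *: f) x = a * f x.
Proof. reflexivity. Qed.

Lemma cLfun_measurable (f : cLfunT) : cmeasurable_fun D f.
Proof. by case/cLfunP: (cLfun_valP f). Qed.

Lemma cLfun_fin_num (f : cLfunT) : cLnorm mu D p f \is a fin_num.
Proof.
by rewrite ge0_fin_numE ?cLnorm_ge0//; case/cLfunP: (cLfun_valP f).
Qed.

Definition cae_eq (f g : cLfunT) : bool := `[< f = g %[ae mu in D] >].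

Let cae_eq_refl : reflexive cae_eq.
Proof. by move=> f; apply/asboolP; exact: ae_eq_refl. Qed.

Let cae_eq_sym : symmetric cae_eq.
Proof. by move=> f g; apply/asboolP/asboolP; exact: ae_eq_sym. Qed.

Let cae_eq_trans : transitive cae_eq.
Proof.
by move=> g f h /asboolP fg /asboolP gh; apply/asboolP; exact: ae_eq_trans gh.
Qed.

Canonical cae_eq_equiv := EquivRel cae_eq cae_eq_refl cae_eq_sym cae_eq_trans.

Local Open Scope quotient_scope.

Definition cLspace : Type := {eq_quot cae_eq}.
HB.instance Definition _ := Choice.on cLspace.
HB.instance Definition _ := EqQuotient.on cLspace.

Lemma cLspace_eqP (f g : cLfunT) :
  \pi_cLspace f = \pi_cLspace g <-> f = g %[ae mu in D].
Proof.
split; first by move/eqquotP/asboolP.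
by move=> fg; apply/eqquotP/asboolP.
Qed.

Lemma repr_cLspace (f : cLfunT) :
  repr (\pi_cLspace f) = f %[ae mu in D].
Proof. by apply/cLspace_eqP; rewrite reprK. Qed.

Definition cLspace_zero : cLspace := \pi_cLspace 0.
Definition cLspace_opp (u : cLspace) : cLspace := \pi_cLspace (- repr u).
Definition cLspace_add (u v : cLspace) : cLspace :=
  \pi_cLspace (repr u + repr v).
Definition cLspace_scale (a : R[i]) (u : cLspace) : cLspace :=
  \pi_cLspace (a *: repr u).

Lemma pi_cLspace_opp (f : cLfunT) :
  cLspace_opp (\pi_cLspace f) = \pi_cLspace (- f).
Proof.
apply/cLspace_eqP; apply: filterS (repr_cLspace f) => x /[apply] fx.
by rewrite !cLfun_valN fx.
Qed.

Lemma pi_cLspace_add (f g : cLfunT) :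
  cLspace_add (\pi_cLspace f) (\pi_cLspace g) = \pi_cLspace (f + g).
Proof.
apply/cLspace_eqP.
apply: filterS2 (repr_cLspace f) (repr_cLspace g) => x fx gx Dx.
by rewrite !cLfun_valD fx// gx.
Qed.

Lemma pi_cLspace_scale (a : R[i]) (f : cLfunT) :
  cLspace_scale a (\pi_cLspace f) = \pi_cLspace (a *: f).
Proof.
apply/cLspace_eqP; apply: filterS (repr_cLspace f) => x /[apply] fx.
by rewrite !cLfun_valZ fx.
Qed.

Let addA : associative cLspace_add.
Proof.
elim/quotW=> f; elim/quotW=> g; elim/quotW=> h.
rewrite (pi_cLspace_add g h) (pi_cLspace_add f g).
by rewrite (pi_cLspace_add f) pi_cLspace_add addrA.
Qed.

Let addC : commutative cLspace_add.
Proof.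
elim/quotW=> f; elim/quotW=> g.
by rewrite (pi_cLspace_add f g) (pi_cLspace_add g f) addrC.
Qed.

Let add0 : left_id cLspace_zero cLspace_add.
Proof. by elim/quotW=> f; rewrite (pi_cLspace_add 0 f) add0r. Qed.

Let addN : left_inverse cLspace_zero cLspace_opp cLspace_add.
Proof.
by elim/quotW=> f; rewrite (pi_cLspace_opp f) (pi_cLspace_add (- f) f) addNr.
Qed.

HB.instance Definition _ := GRing.isZmodule.Build cLspace addA addC add0 addN.

Lemma pi_cLspaceD (f g : cLfunT) :
  \pi_cLspace (f + g) = \pi_cLspace f + \pi_cLspace g.
Proof. by rewrite -pi_cLspace_add. Qed.

Let scaleA a b (u : cLspace) :
  cLspace_scale a (cLspace_scale b u) = cLspace_scale (a * b) u.
Proof. 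
elim/quotW: u => f.
rewrite (pi_cLspace_scale b f) (pi_cLspace_scale a) pi_cLspace_scale.
by rewrite scalerA. Qed.

Let scale1 : left_id 1 cLspace_scale.
Proof. by elim/quotW=> f; rewrite (pi_cLspace_scale 1 f) scale1r. Qed.

Let scaleDr : right_distributive cLspace_scale +%R.
Proof.
move=> a; elim/quotW=> f; elim/quotW=> g.
rewrite -(pi_cLspaceD f g) (pi_cLspace_scale a f) (pi_cLspace_scale a g).
by rewrite (pi_cLspace_scale a (f + g)) -pi_cLspaceD scalerDr.
Qed.

Let scaleDl (u : cLspace) : {morph cLspace_scale^~ u : a b / a + b}.
Proof.
move=> a b; elim/quotW: u => f.
rewrite (pi_cLspace_scale a f) (pi_cLspace_scale b f).
by rewrite (pi_cLspace_scale (a + b) f) -pi_cLspaceD scalerDl.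
Qed.

HB.instance Definition _ :=
  GRing.Zmodule_isLmodule.Build R[i] cLspace scaleA scale1 scaleDr scaleDl.

Lemma pi_cLspaceZ (a : R[i]) (f : cLfunT) :
  \pi_cLspace (a *: f) = a *: \pi_cLspace f.
Proof. by rewrite -pi_cLspace_scale. Qed.

(* The norms of an [R[i]]-normed module are the elements of [R[i]] that come
   from nonnegative elements of [R]. *)
Definition cLspace_norm (u : cLspace) : R[i] :=
  (fine (cLnorm mu D p (repr u)))%:C.

Lemma cLspace_normE (f : cLfunT) :
  cLspace_norm (\pi_cLspace f) = (fine (cLnorm mu D p f))%:C.
Proof.
rewrite /cLspace_norm; congr (fine _)%:C; apply: cLnorm_ae => //.
- exact: cLfun_measurable.
- exact: cLfun_measurable.
- exact: repr_cLspace.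
Qed.

Let ler_cLspace_normD u v :
  cLspace_norm (u + v) <= cLspace_norm u + cLspace_norm v.
Proof.
elim/quotW: u => f; elim/quotW: v => g.
rewrite -pi_cLspaceD !cLspace_normE -rmorphD/= lecR.
have := cLnormD mu mD p1 (cLfun_measurable f) (cLfun_measurable g).
have <- : cLfun_val (f + g) = f \+ g by reflexivity.
rewrite -(fineK (cLfun_fin_num (f + g))) -(fineK (cLfun_fin_num f)).
by rewrite -(fineK (cLfun_fin_num g)) -EFinD lee_fin.
Qed.

Let cLspace_normZ (a : R[i]) u :
  cLspace_norm (a *: u) = `|a| * cLspace_norm u.
Proof.
elim/quotW: u => f; rewrite -pi_cLspaceZ !cLspace_normE.
have -> : cLfun_val (a *: f) = (fun x => a * f x) by reflexivity.
rewrite (cLnormZ mu a mD p1 (cLfun_measurable f)).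
rewrite -(fineK (cLfun_fin_num f)) -EFinM.
by rewrite -(normcC a) -rmorphM.
Qed.

Let cLspace_norm_eq0 u : cLspace_norm u = 0 -> u = 0.
Proof.
elim/quotW: u => f; rewrite cLspace_normE => -[n0]; apply/cLspace_eqP.
apply: (cLnorm_eq0 mD p1 (cLfun_measurable _)).
by rewrite -(fineK (cLfun_fin_num f)) n0.
Qed.

HB.instance Definition _ := Lmodule_isNormed.Build R[i] cLspace
  ler_cLspace_normD cLspace_normZ cLspace_norm_eq0.

End ComplexLspace.

Section MatrixUnits.
Context (R : realType) (X : normedModType R[i]).

Definition banach : Prop :=
  forall F : set_system X, ProperFilter F -> cauchy F -> cvg F.

Definition finite_dimensional (V : set X) : Prop :=
  exists (n : nat) (b : 'I_n -> X),
    V = [set \sum_(i < n) c i *: b i | c in [set: 'I_n -> R[i]]].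

Definition bounded_operator (u : {linear X -> X}) : Prop :=
  bounded_near u (nbhs (0 : X)).

Definition operator_norm (u : X -> X) : \bar R :=
  ereal_sup [set (complex.Re `|u x|)%:E | x in [set x : X | `|x| <= 1]].

Record matrix_units (u : nat -> nat -> {linear X -> X}) : Prop := {
  matrix_units_bounded : forall j k, bounded_operator (u j k) ;
  matrix_units_sup : (ereal_sup [set operator_norm (u jk.1 jk.2) |
    jk in [set: nat * nat]] < +oo)%E ;
  matrix_units_mul : forall j k l m x,
    u j k (u l m x) = (k == l)%:R *: u j m x ;
  matrix_units_sum : forall x, series (fun k => u k k x) @ \oo --> x }.

Definition uniform_multiplicity_infinity_infinite_index : Prop :=
  [/\ banach, ~ finite_dimensional [set: X] &
    exists2 u, matrix_units u & ~ finite_dimensional (range (u 0%N 0%N))].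

End MatrixUnits.
Arguments banach {R} X.
Arguments uniform_multiplicity_infinity_infinite_index {R} X.

(* [R] with the sigma-algebra of Lebesgue measurable sets, on which
   [completed_lebesgue_measure] is defined. *)
Definition lebesgue_type (R : realType) : measurableType _ :=
  caratheodory_type ((wlength (@idfun R))^*)%mu.

Lemma measurable_unit_interval (R : realType) :
  measurable (`[0%R, 1%R]%classic : set (lebesgue_type R)).
Proof.
apply: sub_caratheodory.
exact: (@measurable_itv R `[0%R, 1%R]).
Qed.

Definition Lp01 (R : realType) (p : R) (p1 : 1 <= p) : normedModType R[i] :=
  cLspace (@completed_lebesgue_measure R) (@measurable_unit_interval R) p1.

(* Main.v *)
Require Import Defs.
From HB Require Import structures.
From mathcomp Require Import all_boot all_order all_algebra.
From mathcomp Require Import generic_quotient complex.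
From mathcomp Require Import all_classical all_reals all_analysis.
From mathcomp Require Import measurable_realfun.
From mathcomp Require Import ring lra.

Set Implicit Arguments.
Unset Strict Implicit.
Unset Printing Implicit Defensive.

Import Order.TTheory GRing.Theory Num.Theory.
Import numFieldNormedType.Exports.
Import ComplexField.Normc.

Local Open Scope classical_set_scope.
Local Open Scope ring_scope.
Local Open Scope complex_scope.

(** Split the unit interval, up to the null set {0}, into the dyadic pieces
    A_k = ]2^-(k+1), 2^-k].  The dilation x |-> 2^(j-k) x maps A_j bijectively
    onto A_k and multiplies lengths by 2^(j-k), so that

      (u_jk f) x = 2^((j-k)/p) f (2^(j-k) x)  for x in A_j,
      (u_jk f) x = 0                          elsewhere

    is an isometry from the functions supported on A_k onto those supported on
    A_j, and it kills whatever lives off A_k.  Hence every u_jk is a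
    contraction, the relations u_jk u_lm = delta_kl u_jm hold already for
    functions because dilations compose and the A_k are disjoint, and the
    partial sums of the u_kk f are the restrictions of f to ]2^-n, 1], which
    converge to f in L^p by dominated convergence since p is finite.  The range
    of u_00 is the space of functions supported on ]1/2, 1]; it contains the
    indicators of infinitely many disjoint intervals of positive length, so it
    has infinite dimension, and so has the whole space.

    The construction is carried out over any measure space with a family of
    measure-scaling maps between the pieces of a partition
    ([dilation_matrix_units]).  Three more facts feed it.

    - Completeness ([riesz_fischer], [cLspace_complete]).  Along a sequence
      with ||f_(n+1) - f_n|| <= 2^-n, the partial sums of the
      |f_(n+1) - f_n| have p-norms at most 2, so by monotone convergence the
      whole series is finite almost everywhere; f_n then converges almost
      everywhere, and Fatou's lemma bounds the distance of f_n to the limit.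
      A Cauchy filter is handled by picking such a sequence from it
      ([banach_of_fast_cauchy]).

    - The scaling of Lebesgue measurable sets under dilations ([mu_ext_dil],
      [measurable_dil]).  As these sets are defined by the Caratheodory
      criterion, it is enough to scale the outer measure, and this is done on
      covers by half-open intervals.

    - Linear contractions of the space of p-integrable functions descend to
      almost-everywhere classes ([lift_contraction]): a null function has
      norm 0, and so has its image. *)

(** * Dilations of the Lebesgue measure *)

Section dilation.
Context (R : realType).
Local Notation hlength := (@wlength R idfun).
Local Notation "'mu^*'" := (hlength^*)%mu.
Local Notation dil c := (fun x : R => c * x).

Lemma preimage_dil_oc (c a b : R) : 0 < c ->
  dil c @^-1` `]a, b]%classic = `]c^-1 * a, c^-1 * b]%classic.
Proof.
move=> c0; apply/seteqP; split => x /=; rewrite !in_itv/=.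
  by rewrite ltr_pdivrMl// ler_pdivlMl.
by rewrite ltr_pdivrMl// ler_pdivlMl.
Qed.

Lemma wlength_preimage_dil (c : R) (A : set (ocitv_type R)) : 0 < c ->
  measurable A -> hlength (dil c @^-1` A) = (c^-1%:E * hlength A)%E.
Proof.
move=> c0 [[a b] _ <-]/=; rewrite preimage_dil_oc// !wlength_itv/= !lte_fin.
rewrite ltr_pM2l ?invr_gt0//; case: ifP => _; last by rewrite mule0.
by rewrite -!EFinB -EFinM mulrBr.
Qed.

(* Dilating a cover of [A] gives a cover of the dilated set; the reverse
   inequality comes from applying this one to [c^-1]. *)
Let le_mu_ext_dil (c : R) (A : set R) : 0 < c ->
  (mu^* (dil c @^-1` A) <= c^-1%:E * mu^* A)%E.
Proof.
move=> c0; have ci0 : 0 < c^-1 by rewrite invr_gt0.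
rewrite [X in (_ <= _ * X)%E]/mu_ext -ereal_inf_pZl//.
apply: le_ereal_inf_tmp => _ [_ [F [mF AF] <-] <-].
rewrite -nneseriesZl; last by move=> i _; exact: wlength_ge0.
apply: ereal_inf_lbound; exists (fun n => dil c @^-1` (F n)).
  split => [i|x /AF[n _ Fn]]; last by exists n.
  have [[a b] _ /= <-] := mF i.
  by rewrite preimage_dil_oc//; exact: is_ocitv.
by apply: eq_eseriesr => n _; rewrite -wlength_preimage_dil//; exact: mF.
Qed.

Lemma preimage_dilK (c : R) (A : set R) : c != 0 ->
  dil c^-1 @^-1` (dil c @^-1` A) = A.
Proof. by move=> c0; apply/seteqP; split => x /=; rewrite mulVKf. Qed.

Lemma mu_ext_dil (c : R) (A : set R) : 0 < c ->
  mu^* (dil c @^-1` A) = (c^-1%:E * mu^* A)%E.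
Proof.
move=> c0; apply/eqP; rewrite eq_le le_mu_ext_dil//=.
rewrite -[in leLHS](preimage_dilK A (lt0r_neq0 c0)).
have ci0 : 0 < c^-1 by rewrite invr_gt0.
have := le_mu_ext_dil (dil c @^-1` A) ci0; rewrite invrK => h.
apply: le_trans (lee_wpmul2l _ h) _; first by rewrite lee_fin ltW.
by rewrite muleA -EFinM mulVf ?gt_eqF// mul1e.
Qed.

(** The Caratheodory criterion for a dilated set, tested on [X], is the
    criterion for the original set, tested on the image of [X] under [dil c]. *)
Lemma measurable_dil (c : R) : 0 < c ->
  measurable_fun [set: lebesgue_type R]
    (dil c : lebesgue_type R -> lebesgue_type R).
Proof.
move=> c0 _ A mA; rewrite setTI.
have {}mA Y : mu^* Y = (mu^* (Y `&` A) + mu^* (Y `&` ~` A))%E by exact: mA.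
suff: forall X, mu^* X = (mu^* (X `&` (dil c @^-1` A)) +
  mu^* (X `&` ~` (dil c @^-1` A)))%E by [].
move=> X.
have cn0 : c != 0 by rewrite gt_eqF.
have ci0 : 0 < c^-1 by rewrite invr_gt0.
have XE : X = dil c @^-1` (dil c^-1 @^-1` X).
  by rewrite -{1}(preimage_dilK X (invr_neq0 cn0)) invrK.
rewrite {}XE; set Y := dil c^-1 @^-1` X.
rewrite -[RHS]/(mu^* (dil c @^-1` (Y `&` A)) +
  mu^* (dil c @^-1` (Y `&` ~` A)))%E.
rewrite (mu_ext_dil Y c0) (mu_ext_dil (Y `&` A) c0).
rewrite (mu_ext_dil (Y `&` ~` A) c0).
rewrite (mA Y) ge0_muleDr//; exact: mu_ext_ge0 (wlength_ge0 _) _.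
Qed.

Lemma completed_lebesgue_measure_dil (c : R) (A : set (lebesgue_type R)) :
  0 < c -> completed_lebesgue_measure (dil c @^-1` A) =
           (c^-1%:E * completed_lebesgue_measure A)%E.
Proof. exact: mu_ext_dil. Qed.

Lemma completed_lebesgue_measure_oc (a b : R) : a <= b ->
  completed_lebesgue_measure (`]a, b]%classic : set (lebesgue_type R)) =
  (b - a)%:E.
Proof.
move=> ab; rewrite -[LHS]/(mu^* `]a, b]%classic) measurable_mu_extE/=.
  by rewrite wlength_itv_bnd.
exact: is_ocitv.
Qed.

Lemma measurable_oc (a b : R) :
  measurable (`]a, b]%classic : set (lebesgue_type R)).
Proof. by apply: sub_caratheodory; exact: (@measurable_itv R `]a, b]). Qed.

End dilation.

(** * Completeness of complex L^p spaces *)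

Section Lp_seminorm.
Context d (T : measurableType d) (R : realType).
Variables (mu : {measure set T -> \bar R}) (D : set T) (mD : measurable D).
Variables (p : R) (p1 : 1 <= p).
Implicit Types f g : T -> R[i].

Let p_gt0 : 0 < p. Proof. exact: lt_le_trans ltr01 p1. Qed.

(** Norms are compared through the integral of this function, whose [p^-1]-th
    power is the norm. *)
Definition normp f (x : T) : \bar R := (normc (f x) `^ p)%:E.

Lemma normp_ge0 f x : (0 <= normp f x)%E.
Proof. by rewrite lee_fin powR_ge0. Qed.

Lemma measurable_normp f : cmeasurable_fun D f -> measurable_fun D (normp f).
Proof.
move=> mf; apply/measurable_EFinP.
apply: (@measurableT_comp _ _ _ _ _ _ (@powR R ^~ p)) => //.
exact: measurable_normc.
Qed.

Lemma integral_normpE f :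
  (\int[mu]_(x in D) normp f x = cLnorm mu D p f `^ p)%E.
Proof.
have I0 : (0 <= \int[mu]_(x in D) normp f x)%E.
  by apply: integral_ge0 => x _; exact: normp_ge0.
by rewrite /cLnorm -poweRrM mulVf ?gt_eqF// poweRe1.
Qed.

Lemma cLnorm_leP f (r : R) : 0 <= r ->
  (cLnorm mu D p f <= r%:E)%E <->
  (\int[mu]_(x in D) normp f x <= (r `^ p)%:E)%E.
Proof.
move=> r0; have I0 : (0 <= \int[mu]_(x in D) normp f x)%E.
  by apply: integral_ge0 => x _; exact: normp_ge0.
split=> h.
  rewrite integral_normpE -poweR_EFin gt0_ler_poweR ?(ltW p_gt0)//.
    by rewrite in_itv/= leey cLnorm_ge0.
  by rewrite in_itv/= leey lee_fin r0.
have -> : r%:E = ((r `^ p)%:E `^ p^-1)%E :> \bar R.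
  by rewrite poweR_EFin -powRrM mulfV ?gt_eqF// powRr1.
rewrite /cLnorm gt0_ler_poweR ?invr_ge0 ?(ltW p_gt0)//.
  by rewrite in_itv/= leey I0.
by rewrite in_itv/= leey lee_fin powR_ge0.
Qed.

Lemma le_cLnorm f g : cmeasurable_fun D f -> cmeasurable_fun D g ->
  (forall x, D x -> normc (f x) <= normc (g x)) ->
  (cLnorm mu D p f <= cLnorm mu D p g)%E.
Proof.
move=> mf mg fg; apply: gt0_ler_poweR.
- by rewrite invr_ge0 ltW.
- by rewrite in_itv/= leey integral_ge0// => x _; rewrite normp_ge0.
- by rewrite in_itv/= leey integral_ge0// => x _; rewrite normp_ge0.
apply: (@ge0_le_integral _ _ _ mu D mD (normp f) (normp g)).
- by move=> x _; rewrite normp_ge0.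
- exact: measurable_normp.
- exact: measurable_normp.
move=> x Dx; rewrite lee_fin ge0_ler_powR ?nnegrE ?normc_ge0 ?(ltW p_gt0)//.
exact: fg.
Qed.

Lemma cmeasurable_funB f g : cmeasurable_fun D f -> cmeasurable_fun D g ->
  cmeasurable_fun D (f \- g).
Proof.
move=> mf mg; have -> : f \- g = f \+ (fun x => -1 * g x).
  by apply/funext => x; rewrite /= mulN1r.
by apply: cmeasurable_funD => //; exact: cmeasurable_funZ.
Qed.

End Lp_seminorm.

Section pointwise.
Context (R : realType).

Lemma ler_Re_normc (z : R[i]) : `|complex.Re z| <= normc z.
Proof.
case: z => a b /=; rewrite -(sqrtr_sqr a) ler_wsqrtr//.
by rewrite lerDl sqr_ge0.
Qed.

Lemma ler_Im_normc (z : R[i]) : `|complex.Im z| <= normc z.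
Proof.
case: z => a b /=; rewrite -(sqrtr_sqr b) ler_wsqrtr//.
by rewrite lerDr sqr_ge0.
Qed.

Lemma ler_normc_ReIm (z : R[i]) :
  normc z <= `|complex.Re z| + `|complex.Im z|.
Proof.
case: z => a b /=; rewrite -[leRHS]ger0_norm ?addr_ge0//.
rewrite -sqrtr_sqr ler_wsqrtr// sqrrD -(real_normK (num_real a)).
rewrite -(real_normK (num_real b)) lerD2r lerDl.
by rewrite mulrn_wge0// mulr_ge0.
Qed.

Lemma ler_dist_normc (z w : R[i]) : `|normc z - normc w| <= normc (z - w).
Proof.
have hz := ler_normcD (z - w) w; have hw := ler_normcD (w - z) z.
rewrite subrK in hz; rewrite subrK -[w - z]opprB normcN in hw.
by rewrite ler_norml; apply/andP; split; lra.
Qed.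

(** At a positive limit this is the differentiability of the power function; at
    0, where that fails, a nonnegative number below [e `^ p^-1] has [p]-th
    power below [e]. *)
Lemma cvg_powR (p : R) (u : R^nat) (l : R) : 0 < p -> (forall n, 0 <= u n) ->
  u @ \oo --> l -> u n `^ p @[n --> \oo] --> l `^ p.
Proof.
move=> p0 u0 ul; have l0 : 0 <= l.
  by rewrite -(cvg_lim _ ul)//; apply: limr_ge; [exact: cvgP ul|exact: nearW].
have [l_gt0|] := ltP 0 l.
  have cl : {for l, continuous (fun a : R => a `^ p)}.
    apply: differentiable_continuous; apply/derivable1_diffP.
    by have [] := is_derive1_powR p l_gt0.
  exact: (cvg_comp u (fun a : R => a `^ p) ul cl).
move=> l_le0; have {l_le0 l0} l0 : l = 0 by apply/eqP; rewrite eq_le l_le0.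
rewrite {l}l0 powR0 ?gt_eqF// in ul *.
apply/cvgrPdist_lt => e e0.
have /cvgrPdist_lt/(_ (e `^ p^-1) (powR_gt0 _ e0)) := ul.
apply: filterS => n; rewrite !sub0r !normrN.
rewrite ger0_norm// ger0_norm ?powR_ge0// => h.
rewrite -[ltRHS]powRr1 ?(ltW e0)// -(@mulVf _ p) ?gt_eqF// powRrM.
by rewrite gt0_ltr_powR ?nnegrE ?powR_ge0.
Qed.

Lemma cvg_abs_telescope (u : R^nat) (a : R^nat) :
  (forall n, `|u n.+1 - u n| <= a n) -> cvgn (series a) -> cvgn u.
Proof.
move=> ua ca.
have a0 n : 0 <= a n by apply: le_trans (ua n).
have ct : cvgn (series (telescope u)).
  apply: normed_cvg; apply: series_le_cvg ca => // n; exact: normr_ge0.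
have -> : u = (fun n => series (telescope u) n + u 0%N).
  by apply/funext => n; rewrite telescopeK/= subrK.
by apply: is_cvgD => //; exact: is_cvg_cst.
Qed.

Lemma sum_half N m : \sum_(m <= n < N) 2^-1 ^+ n <= 2 * 2^-1 ^+ m :> R.
Proof.
have [Nm|/ltnW mN] := leqP N m; first by rewrite big_geq// mulr_ge0// exprn_ge0.
suff : \sum_(m <= n < N) 2^-1 ^+ n = 2 * 2^-1 ^+ m - 2 * 2^-1 ^+ N :> R.
  by move=> ->; rewrite lerBlDr lerDl mulr_ge0// exprn_ge0.
rewrite -(subnKC mN); elim: (N - m)%N => [|k ih].
  by rewrite addn0 big_geq// subrr.
rewrite addnS big_nat_recr ?leq_addr//= ih exprS; lra.
Qed.

Lemma limn_einf_ub (u : (\bar R)^nat) (c : \bar R) :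
  (forall n, (u n <= c)%E) -> (limn_einf u <= c)%E.
Proof.
move=> uc; rewrite limn_einf_lim; apply: lime_le; first exact: is_cvg_einfs.
apply: nearW => n; apply: le_trans (uc n).
by apply: ereal_inf_lbound; exists n => /=.
Qed.

End pointwise.

Section riesz_fischer.
Context d (T : measurableType d) (R : realType).
Variables (mu : {measure set T -> \bar R}) (D : set T) (mD : measurable D).
Variables (p : R) (p1 : 1 <= p).
Variable f : nat -> T -> R[i].
Hypothesis mf : forall n, cmeasurable_fun D (f n).
Hypothesis fastf :
  forall n, (cLnorm mu D p (f n.+1 \- f n)%R <= (2^-1 ^+ n)%:E)%E.

Let p_gt0 : 0 < p. Proof. exact: lt_le_trans ltr01 p1. Qed.

Let a n x := normc (f n.+1 x - f n x).

(* The partial sums of the |f_(n+1) - f_n| are made complex-valued so that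
   Minkowski's inequality for complex functions applies to them. *)
Let Q N x : R[i] := (\sum_(0 <= n < N) a n x)%:C.

Let normcQ N x : normc (Q N x) = \sum_(0 <= n < N) a n x.
Proof.
rewrite /Q /= expr0n addr0 sqrtr_sqr ger0_norm// sumr_ge0// => n _.
exact: normc_ge0.
Qed.

Let ma n : measurable_fun D (a n).
Proof. by apply: measurable_normc => //; exact: cmeasurable_funB. Qed.

Let mQ N : cmeasurable_fun D (Q N).
Proof.
split; last exact: measurable_cst.
rewrite /Q/=; exact: measurable_sum.
Qed.

Let NQ N : (cLnorm mu D p (Q N) <= (2 : R)%:E)%E.
Proof.
suff h : (cLnorm mu D p (Q N) <= (\sum_(0 <= n < N) 2^-1 ^+ n)%:E)%E.
  apply: le_trans h _; rewrite lee_fin (le_trans (sum_half _ N 0))//.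
  by rewrite expr0 mulr1.
elim: N => [|N ih].
  rewrite big_geq//; apply/cLnorm_leP => //.
  rewrite integral0_eq ?powR0 ?gt_eqF// => x _.
  by rewrite /normp normcQ big_geq// powR0// gt_eqF.
have -> : Q N.+1 = Q N \+ (fun x => (a N x)%:C).
  by apply/funext => x /=; rewrite /Q big_nat_recr//= rmorphD.
have maN : cmeasurable_fun D (fun x => (a N x)%:C).
  by split; [exact: ma|exact: measurable_cst].
rewrite big_nat_recr//= EFinD; apply: le_trans (cLnormD mu mD p1 (mQ N) maN) _.
apply: leeD => //; apply: le_trans (fastf N).
apply: le_cLnorm => //; first exact: cmeasurable_funB.
move=> x _ /=; rewrite expr0n addr0 sqrtr_sqr ger0_norm// normc_ge0//.
Qed.

Let ndQ x : nondecreasing_seq (fun N => \sum_(0 <= n < N) a n x).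
Proof.
apply: nondecreasing_series => n _ _; exact: normc_ge0.
Qed.

Let ndQp x : nondecreasing_seq (fun N => normp p (Q N) x).
Proof.
move=> m n mn; rewrite /normp !normcQ lee_fin ge0_ler_powR ?nnegrE//.
- exact: ltW.
- by rewrite sumr_ge0// => k _; exact: normc_ge0.
- by rewrite sumr_ge0// => k _; exact: normc_ge0.
exact: ndQ.
Qed.

(* The total variation of the sequence [f n x], to the power [p]: where it is
   finite, the sequence converges. *)
Let L x := limn (fun N => normp p (Q N) x).

Let integrableL : mu.-integrable D L.
Proof.
have mG n : measurable_fun D (normp p (Q n)) by exact: measurable_normp.
have cG x : cvgn (fun N => normp p (Q N) x).
  exact: ereal_nondecreasing_is_cvgn.
have mL : measurable_fun D L.
  by apply: (emeasurable_fun_cvg _ _ mG) => x _; exact: cG.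
apply/integrableP; split => //.
under eq_integral.
  move=> x _; rewrite gee0_abs; last first.
    by apply: lime_ge => //; apply: nearW => n; exact: normp_ge0.
  over.
rewrite monotone_convergence//; last by move=> n x _; exact: normp_ge0.
apply: (@le_lt_trans _ _ (2 `^ p)%:E); last exact: ltry.
apply: lime_le; last first.
  by apply: nearW => n; apply/cLnorm_leP => //; exact: NQ.
apply: ereal_nondecreasing_is_cvgn => m n mn.
apply: ge0_le_integral => // x _; try exact: normp_ge0.
exact: ndQp.
Qed.

Let cvg_series_a x : L x \is a fin_num -> cvgn (series (a ^~ x)).
Proof.
move=> Lfin; apply: nondecreasing_is_cvgn; first exact: ndQ.
exists (fine (L x) `^ p^-1) => _ [N _ <-].
have s0 : 0 <= series (a ^~ x) N.
  by rewrite /series/= sumr_ge0// => k _; exact: normc_ge0.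
have : (normp p (Q N) x <= L x)%E.
  apply: lime_ge; first exact: ereal_nondecreasing_is_cvgn.
  by near=> n; apply: ndQp; near: n; exact: nbhs_infty_ge.
rewrite -(fineK Lfin) /normp normcQ lee_fin => h.
have p0 : p != 0 by rewrite gt_eqF.
rewrite -[leLHS]powRr1// -(mulfV p0) powRrM.
rewrite ge0_ler_powR ?nnegrE ?invr_ge0 ?powR_ge0 ?(ltW p_gt0)//.
by apply: le_trans h; exact: powR_ge0.
Unshelve. all: by end_near. Qed.

(* Taking upper limits makes [g] measurable on all of [D], without having to
   single out the set where the sequence converges. *)
Let g x : R[i] :=
  Complex (fine (limn_esup (fun n => (complex.Re (f n x))%:E)))
          (fine (limn_esup (fun n => (complex.Im (f n x))%:E))).

Let mg : cmeasurable_fun D g.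
Proof.
by split; apply: (measurableT_comp (fine_measurable measurableT));
  apply: measurable_fun_limn_esup => n; apply/measurable_EFinP; case: (mf n).
Qed.

Let cvg_g x : L x \is a fin_num -> normc (f n x - g x) @[n --> \oo] --> (0 : R).
Proof.
move=> /cvg_series_a ca.
have ReB (z w : R[i]) : complex.Re (z - w) = complex.Re z - complex.Re w.
  by case: z w => ? ? [].
have ImB (z w : R[i]) : complex.Im (z - w) = complex.Im z - complex.Im w.
  by case: z w => ? ? [].
have cR : complex.Re (f n x) @[n --> \oo] --> complex.Re (g x).
  have /cvg_ex[l ul] : cvgn (fun n => complex.Re (f n x)).
    apply: cvg_abs_telescope ca => n; rewrite -ReB; exact: ler_Re_normc.
  have ulE : (complex.Re (f n x))%:E @[n --> \oo] --> l%:E.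
    exact: cvg_EFin (nearW _ _) ul.
  by rewrite /g/= (cvg_limn_einf_sup ulE).2.
have cI : complex.Im (f n x) @[n --> \oo] --> complex.Im (g x).
  have /cvg_ex[l ul] : cvgn (fun n => complex.Im (f n x)).
    apply: cvg_abs_telescope ca => n; rewrite -ImB; exact: ler_Im_normc.
  have ulE : (complex.Im (f n x))%:E @[n --> \oo] --> l%:E.
    exact: cvg_EFin (nearW _ _) ul.
  by rewrite /g/= (cvg_limn_einf_sup ulE).2.
apply: (@squeeze_cvgr _ _ _ _ (cst 0) (fun n =>
   `|complex.Re (f n x) - complex.Re (g x)| +
   `|complex.Im (f n x) - complex.Im (g x)|)).
- apply: nearW => n; rewrite normc_ge0 andTb.
  by rewrite -ReB -ImB ler_normc_ReIm.
- exact: cvg_cst.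
rewrite -[X in _ --> X]addr0.
by apply: cvgD; apply/norm_cvg0P; exact/subr_cvg0.
Qed.

(** Since f_n - g is almost everywhere the limit of f_n - f_(m+n) as m tends to
    infinity, Fatou's lemma bounds its norm by the common bound
    2^-n + 2^-(n+1) + ... = 2 * 2^-n of theirs. *)
Lemma riesz_fischer : exists2 g : T -> R[i], cmeasurable_fun D g &
  forall n, (cLnorm mu D p (f n \- g)%R <= (2 * 2^-1 ^+ n)%:E)%E.
Proof.
exists g => // n; apply/cLnorm_leP => //.
have mfB k m : cmeasurable_fun D (f k \- f m) by exact: cmeasurable_funB.
have tailf m : (cLnorm mu D p (f n \- f (m + n)%N)%R <= (2 * 2^-1 ^+ n)%:E)%E.
  apply: (@le_trans _ _ (\sum_(n <= k < m + n) 2^-1 ^+ k)%:E); last first.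
    by rewrite lee_fin sum_half.
  elim: m => [|m ih].
    rewrite add0n big_geq//; apply/cLnorm_leP => //.
    rewrite integral0_eq ?powR0 ?gt_eqF// => x _.
    by rewrite /normp /= subrr normc0 powR0// gt_eqF.
  rewrite addSn big_nat_recr ?leq_addl//= EFinD.
  have -> : f n \- f (m + n).+1 =
      (f n \- f (m + n)%N) \+ (fun x => -1 * (f (m + n).+1 x - f (m + n)%N x)).
    by apply/funext => x /=; rewrite mulN1r opprB addrA subrK.
  have mB : cmeasurable_fun D (fun x => -1 * (f (m + n).+1 x - f (m + n)%N x)).
    by apply: cmeasurable_funZ; exact: (mfB (m + n).+1 (m + n)%N).
  apply: le_trans (cLnormD mu mD p1 (mfB _ _) mB) _.
  apply: leeD => //.
  rewrite (cLnormZ mu (-1) mD p1 (mfB (m + n).+1 (m + n)%N)).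
  by rewrite normcN normc1 mul1e.
have aeE : {ae mu, forall x, D x ->
    normp p (f n \- g)%R x =
    limn_einf (fun m => normp p (f n \- f (m + n)%N)%R x)}.
  apply: filterS (integrable_ae mD integrableL) => x /[apply] /cvg_g Lx.
  suff h : normp p (f n \- f (m + n)%N)%R x @[m --> \oo] -->
      normp p (f n \- g)%R x.
    by rewrite (cvg_limn_einf_sup h).1.
  apply: cvg_EFin; first exact: nearW.
  apply: cvg_powR => [//|m|]; first exact: normc_ge0.
  move: Lx; rewrite -(cvg_shiftn n) => /cvgrPdist_le Lx.
  apply/cvgrPdist_le => e /Lx; apply: filterS => m.
  rewrite sub0r normrN ger0_norm ?normc_ge0//.
  apply: le_trans; apply: le_trans (ler_dist_normc _ _) _.
  by rewrite /= opprB addrC addrA subrK.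
rewrite (ae_eq_integral _ _ mD _ _ aeE); last 2 first.
  by apply: measurable_normp => //; exact: cmeasurable_funB.
  apply: (measurableT_comp (@oppe_measurable _ setT)).
  apply: measurable_fun_limn_esup => m.
  apply: (measurableT_comp (@oppe_measurable _ setT)).
  exact: measurable_normp.
apply: le_trans (fatou mu mD _ _) _.
- by move=> m; exact: measurable_normp.
- by move=> m x _; exact: normp_ge0.
by apply: limn_einf_ub => m; apply/cLnorm_leP; rewrite ?mulr_ge0 ?exprn_ge0.
Qed.

End riesz_fischer.

Section banach_criterion.
Context (R : realType) (X : normedModType R[i]).

Lemma gt0_complexE (z : R[i]) :
  0 < z -> z = (complex.Re z)%:C /\ 0 < complex.Re z.
Proof.
by case: z => a b; rewrite ltcE/= => /andP[/eqP-> a0]; split.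
Qed.

Lemma exprn_half_lt (e : R) : 0 < e -> exists n, 2^-1 ^+ n < e.
Proof.
move=> e0.
have /cvgrPdist_lt/(_ _ e0) : (2^-1 : R) ^+ n @[n --> \oo] --> (0 : R).
  by apply: cvg_expr; rewrite gtr0_norm// invf_lt1// ltr1n.
move=> /filter_ex[n]; rewrite sub0r normrN gtr0_norm ?exprn_gt0//.
by exists n.
Qed.

(** A Cauchy filter contains balls of radius 2^-n / 4; the centers of these
    balls form a sequence of the required kind, because consecutive balls meet,
    and the filter converges to its limit. *)
Lemma banach_of_fast_cauchy :
  (forall u : nat -> X,
    (forall n, `|u n.+1 - u n| <= (2^-1 ^+ n : R)%:C) ->
    exists l, forall n, `|l - u n| <= (2 * 2^-1 ^+ n : R)%:C) ->
  banach X.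
Proof.
move=> fast F FF Fc.
pose r n : R := 2^-1 ^+ n / 4.
have r0 n : 0 < r n by rewrite /r divr_gt0// exprn_gt0.
have /choice[u uF] : forall n, exists x : X, F (ball x (r n)%:C).
  by move=> n; apply: (iffLR (cauchyP F) Fc); rewrite ltcR.
have [n|l ul] := fast u.
  have FI : F (ball (u n) (r n)%:C `&` ball (u n.+1) (r n.+1)%:C).
    exact: filterI.
  have [x [xn xn1]] := filter_ex FI.
  move: xn xn1; rewrite -!ball_normE/= => xn xn1.
  rewrite -(subrK x (u n.+1)) -addrA.
  apply: le_trans (ler_normD _ _) _.
  rewrite [X in _ + X]distrC.
  apply: le_trans (lerD (ltW xn1) (ltW xn)) _.
  rewrite -rmorphD/= lecR /r exprS.
  have hn : 0 < (2^-1 ^+ n : R) by rewrite exprn_gt0.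
  lra.
apply/cvg_ex; exists l; apply/cvgrPdist_lt => e /gt0_complexE[-> e0].
have e4 : 0 < complex.Re e / 4 by rewrite divr_gt0.
have [n ne] := exprn_half_lt e4.
have := uF n; apply: filterS => x; rewrite -ball_normE/= => xn.
rewrite -(subrK (u n) l) -addrA; apply: le_lt_trans (ler_normD _ _) _.
apply: le_lt_trans (lerD (ul n) (ltW xn)) _.
rewrite -rmorphD/= ltcR /r.
have hn : 0 < (2^-1 ^+ n : R) by rewrite exprn_gt0.
lra.
Qed.

End banach_criterion.

Section cLspace_theory.
Context d (T : measurableType d) (R : realType).
Variables (mu : {measure set T -> \bar R}) (D : set T) (mD : measurable D).
Variables (p : R) (p1 : 1 <= p).
Local Notation cLfunT := (cLfunType mu mD p1).
Local Notation X := (cLspace mu mD p1).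
Local Open Scope quotient_scope.

Lemma norm_pi_cLspace (f : cLfunT) :
  `|\pi_X f : X| = (fine (cLnorm mu D p f))%:C.
Proof. exact: cLspace_normE. Qed.

Lemma pi_cLspaceB (f g : cLfunT) : \pi_X (f - g) = \pi_X f - \pi_X g :> X.
Proof. by rewrite pi_cLspaceD -pi_cLspace_opp. Qed.

Lemma pi_cLspace_sum n (f : nat -> cLfunT) :
  \pi_X (\sum_(0 <= i < n) f i) = \sum_(0 <= i < n) \pi_X (f i) :> X.
Proof.
elim: n => [|n ih]; first by rewrite !big_geq.
by rewrite !big_nat_recr//= pi_cLspaceD ih.
Qed.

Lemma cLfun_val_sum n (f : nat -> cLfunT) x :
  (\sum_(0 <= i < n) f i : cLfunT) x = \sum_(0 <= i < n) f i x.
Proof.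
elim: n => [|n ih]; first by rewrite !big_geq.
by rewrite big_nat_recr// [in RHS]big_nat_recr// -ih.
Qed.

(** A contraction sends functions that agree almost everywhere to functions at
    distance 0, so it acts on classes, with the same bound. *)
Lemma lift_contraction (F : cLfunT -> cLfunT) : linear F ->
  (forall f, (cLnorm mu D p (F f) <= cLnorm mu D p f)%E) ->
  exists2 U : {linear X -> X}, (forall f, U (\pi_X f) = \pi_X (F f)) &
    forall u, `|U u| <= `|u|.
Proof.
move=> lF cF.
have FB f g : F (f - g) = F f - F g.
  by rewrite addrC -scaleN1r lF scaleN1r addrC.
have normF f : `|\pi_X (F f) : X| <= `|\pi_X f : X|.
  by rewrite !norm_pi_cLspace lecR fine_le ?cLfun_fin_num.
pose U0 (u : X) : X := \pi_X (F (repr u)).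
have U0E f : U0 (\pi_X f) = \pi_X (F f).
  apply/eqP; rewrite -subr_eq0 -normr_le0 -pi_cLspaceB -FB.
  by apply: le_trans (normF _) _; rewrite pi_cLspaceB reprK subrr normr0.
have lU : linear U0.
  move=> a; elim/quotW => f; elim/quotW => g.
  by rewrite -pi_cLspaceZ -pi_cLspaceD !U0E lF pi_cLspaceD pi_cLspaceZ.
pose U : {linear X -> X} := HB.pack U0 (GRing.isLinear.Build _ _ _ _ U0 lU).
exists U => //; elim/quotW => f.
rewrite -[U _]/(U0 (\pi_X f)) U0E; exact: normF.
Qed.

Lemma cLspace_complete : banach X.
Proof.
apply: banach_of_fast_cauchy => u fastu.
have fastf n :
    (cLnorm mu D p (repr (u n.+1) \- repr (u n))%R <= (2^-1 ^+ n)%:E)%E.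
  have := fastu n; rewrite -(reprK (u n.+1)) -(reprK (u n)) -pi_cLspaceB.
  by rewrite norm_pi_cLspace lecR !reprK -lee_fin fineK ?cLfun_fin_num.
have [g mg Ng] :=
  riesz_fischer mD p1 (fun n => cLfun_measurable (repr (u n))) fastf.
have m0 := cLfun_measurable (repr (u 0%N)).
have gL : g \in cLfun mu D p.
  apply/cLfunP; split => //.
  (* [g] is p-integrable, being at finite distance from the first term *)
  have -> : g = (repr (u 0%N) : T -> R[i]) \+
      (fun x => -1 * (repr (u 0%N) x - g x)).
    by apply/funext => x /=; rewrite mulN1r opprB addrCA subrr addr0.
  have mB : cmeasurable_fun D ((repr (u 0%N) : T -> R[i]) \- g).
    exact: cmeasurable_funB.
  apply: le_lt_trans (cLnormD mu mD p1 m0 (cmeasurable_funZ (-1) mB)) _.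
  rewrite (cLnormZ mu (-1) mD p1 mB) normcN normc1 mul1e.
  apply: lte_add_pinfty; last exact: le_lt_trans (Ng 0%N) (ltry _).
  by case/cLfunP: (cLfun_valP (repr (u 0%N))).
exists (\pi_X (CLfun mD p1 gL)) => n.
rewrite distrC -{1}(reprK (u n)) -pi_cLspaceB norm_pi_cLspace lecR.
by rewrite -lee_fin fineK ?cLfun_fin_num//; exact: Ng.
Qed.

End cLspace_theory.

(** * Matrix units from measure-scaling maps *)

Section contractions.
Context (R : realType) (X : normedModType R[i]).
Implicit Types u : {linear X -> X}.

Lemma contraction_bounded u : (forall x, `|u x| <= `|x|) -> bounded_operator u.
Proof.
move=> u1; apply/linear_boundedP; exists 1; split; first exact: real1.
by move=> r r1 x; rewrite (le_trans (u1 x))// ler_peMl// ltW.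
Qed.

Lemma contraction_operator_norm u :
  (forall x, `|u x| <= `|x|) -> (operator_norm u <= 1%:E)%E.
Proof.
move=> u1; apply: ge_ereal_sup => _ [x /= x1 <-].
by have := le_trans (u1 x) x1; rewrite lecE/= lee_fin => /andP[].
Qed.

End contractions.

Section weighted_composition.
Context d (T : measurableType d) (R : realType).
Variables (mu : {measure set T -> \bar R}) (D : set T) (mD : measurable D).
Variables (p : R) (p1 : 1 <= p).
Variables (B : set T) (phi : T -> T) (w c : R).
Hypotheses (mB : measurable B) (BD : B `<=` D) (phiBD : phi @^-1` B `<=` D).
Hypothesis mphi : measurable_fun [set: T] phi.
Hypotheses (c0 : 0 <= c) (w0 : 0 <= w) (wc : w `^ p * c = 1).
Hypothesis mu_phi : forall E, measurable E ->
  mu (phi @^-1` E) = (c%:E * mu E)%E.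
Implicit Types f g : T -> R[i].

Let p_gt0 : 0 < p. Proof. exact: lt_le_trans ltr01 p1. Qed.

(** With [w `^ p * c = 1] the weight compensates for the factor [c] by which
    [phi] rescales the measure, so that the norm of [wcomp f] is that of [f] on
    [B]. *)
Definition wcomp f : T -> R[i] :=
  fun x => if x \in phi @^-1` B then w%:C * f (phi x) else 0.

Let mphiB : measurable (phi @^-1` B).
Proof. by rewrite -[_ @^-1` _]setTI; exact: mphi. Qed.

Lemma cmeasurable_wcomp f : cmeasurable_fun D f -> cmeasurable_fun D (wcomp f).
Proof.
move=> [mr mi].
have mcomp (h : T -> R) : measurable_fun D h ->
    measurable_fun D ((fun x => w * h (phi x)) \_ (phi @^-1` B)).
  move=> mh; apply/measurable_restrict => //; rewrite setIidr//.
  apply: measurable_funM; first exact: measurable_cst.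
  apply: (measurable_comp mB); first by move=> _ [x Bx <-].
    exact: measurable_funS mh.
  exact: measurable_funTS.
split.
  rewrite (_ : (fun x => _) =
    (fun x => w * complex.Re (f (phi x))) \_ (phi @^-1` B)).
    exact: mcomp mr.
  apply/funext => x; rewrite /wcomp patchE; case: ifP => // _.
  by case: (f (phi x)) => a b /=; rewrite mul0r subr0.
rewrite (_ : (fun x => _) =
  (fun x => w * complex.Im (f (phi x))) \_ (phi @^-1` B)).
  exact: mcomp mi.
apply/funext => x; rewrite /wcomp patchE; case: ifP => // _.
by case: (f (phi x)) => a b /=; rewrite mul0r addr0.
Qed.

Lemma integral_normp_wcomp f : cmeasurable_fun D f ->
  (\int[mu]_(x in D) normp p (wcomp f) x = \int[mu]_(x in B) normp p f x)%E.
Proof.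
move=> mf.
have mfB : measurable_fun B (normp p f).
  by apply: (measurable_funS mD) => //; exact: measurable_normp.
have -> : normp p (wcomp f) =
    (fun x => (w `^ p)%:E * normp p f (phi x))%E \_ (phi @^-1` B).
  apply/funext => x; rewrite /normp /wcomp patchE; case: ifP => _.
    rewrite normcM powRM ?normc_ge0// EFinM; congr ((_ `^ _)%:E * _)%E.
    by rewrite /= expr0n addr0 sqrtr_sqr ger0_norm.
  by rewrite normc0 powR0// gt_eqF.
rewrite -integral_mkcondr setIidr// ge0_integralZl_EFin//; last 3 first.
- by move=> x _; exact: normp_ge0.
- apply: (measurable_comp mB) mfB _; first by move=> _ [x Bx <-].
  exact: measurable_funTS.
- exact: powR_ge0.
rewrite -[X in (_ * X)%E](@ge0_integral_pushforward _ _ _ _ _ _ mphi mu B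
  (normp p f))//; last by move=> x _; exact: normp_ge0.
have -> : (\int[pushforward mu phi]_(y in B) normp p f y =
    \int[mscale (NngNum c0) mu]_(y in B) normp p f y)%E.
  by apply: eq_measure_integral => E mE _; exact: mu_phi.
rewrite ge0_integral_mscale//; last by move=> x _; exact: normp_ge0.
by rewrite muleA -EFinM wc mul1e.
Qed.

Lemma le_cLnorm_wcomp f : cmeasurable_fun D f ->
  (cLnorm mu D p (wcomp f) <= cLnorm mu D p f)%E.
Proof.
move=> mf; apply: gt0_ler_poweR.
- by rewrite invr_ge0 ltW.
- by rewrite in_itv/= leey integral_ge0// => x _; rewrite normp_ge0.
- by rewrite in_itv/= leey integral_ge0// => x _; rewrite normp_ge0.
rewrite -[leLHS]/(\int[mu]_(x in D) normp p (wcomp f) x)%E.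
rewrite integral_normp_wcomp//; apply: ge0_subset_integral => //.
  exact: measurable_normp.
by move=> x _; exact: normp_ge0.
Qed.

Lemma wcomp_cLfun f : f \in cLfun mu D p -> wcomp f \in cLfun mu D p.
Proof.
move=> /cLfunP[mf nf]; apply/cLfunP; split; first exact: cmeasurable_wcomp.
exact: le_lt_trans (le_cLnorm_wcomp mf) nf.
Qed.

Definition cLfun_wcomp (f : cLfunType mu mD p1) : cLfunType mu mD p1 :=
  CLfun mD p1 (wcomp_cLfun (cLfun_valP f)).

Lemma cLfun_wcomp_linear : linear cLfun_wcomp.
Proof.
move=> a f g; apply: val_inj; apply/funext => x.
rewrite -[LHS]/(wcomp (a *: f + g) x).
rewrite -[RHS]/(a * wcomp f x + wcomp g x) /wcomp.
case: ifP => _; last by rewrite mulr0 addr0.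
rewrite -[(a *: f + g) _]/(a * f (phi x) + g (phi x)).
by rewrite mulrDr !mulrA [w%:C * a]mulrC.
Qed.

End weighted_composition.

Section dominated.
Context d (T : measurableType d) (R : realType).
Variables (mu : {measure set T -> \bar R}) (D : set T) (mD : measurable D).
Variables (p : R) (p1 : 1 <= p).

Let p_gt0 : 0 < p. Proof. exact: lt_le_trans ltr01 p1. Qed.

(** Dominated convergence, for sequences that are eventually 0 at almost every
    point. *)
Lemma cLnorm_dominated (h : nat -> T -> R[i]) (f : T -> R[i]) :
  (forall n, cmeasurable_fun D (h n)) -> f \in cLfun mu D p ->
  (forall n x, D x -> normc (h n x) <= normc (f x)) ->
  {ae mu, forall x, D x -> \forall n \near \oo, h n x = 0} ->
  forall e, 0 < e -> \forall n \near \oo, (cLnorm mu D p (h n) <= e%:E)%E.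
Proof.
move=> mh /cLfunP[mf nf] hf h0 e e0.
have mnh n : measurable_fun D (normp p (h n)) by exact: measurable_normp.
have intf : mu.-integrable D (normp p f).
  apply/integrableP; split; first exact: measurable_normp.
  under eq_integral do rewrite gee0_abs ?normp_ge0//.
  by rewrite integral_normpE// poweR_lty.
have [||_ _] := @dominated_convergence _ _ _ mu D mD (fun n => normp p (h n))
    (cst 0%E) (normp p f) mnh (measurable_cst _) _ intf.
- apply: filterS h0 => x /[apply] hx.
  apply: cvg_near_cst; apply: filterS hx => n hnx.
  by rewrite /normp hnx normc0 powR0// gt_eqF.
- apply/aeW => x n Dx; rewrite gee0_abs ?normp_ge0// lee_fin.
  by rewrite ge0_ler_powR ?nnegrE ?normc_ge0 ?(ltW p_gt0)// hf.
rewrite integral0 => /fine_cvgP[finI cI].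
have ep : 0 < e `^ p by rewrite powR_gt0.
move/cvgrPdist_le : cI => /(_ _ ep) cI.
near=> n; apply/cLnorm_leP => //; first exact: ltW.
have fn : (\int[mu]_(x in D) normp p (h n) x)%E \is a fin_num by near: n.
rewrite -(fineK fn) lee_fin.
have : `|0 - fine (\int[mu]_(x in D) normp p (h n) x)%E| <= e `^ p by near: n.
by rewrite sub0r normrN; apply: le_trans; exact: ler_norm.
Unshelve. all: by end_near. Qed.

End dominated.

Section dilation_matrix_units.
Context d (T : measurableType d) (R : realType).
Variables (mu : {measure set T -> \bar R}) (D : set T) (mD : measurable D).
Variables (p : R) (p1 : 1 <= p).
Variables (A : nat -> set T) (phi : nat -> nat -> T -> T) (c : nat -> nat -> R).
Hypotheses (mA : forall k, measurable (A k)) (AD : forall k, A k `<=` D).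
Hypothesis tA : trivIset [set: nat] A.
Hypothesis coverA : {ae mu, forall x, D x -> exists k, A k x}.
Hypothesis mphi : forall j k, measurable_fun [set: T] (phi j k).
Hypothesis phiA : forall j k, phi j k @^-1` (A k) = A j.
Hypothesis phi_comp : forall j k l x, phi k l (phi j k x) = phi j l x.
Hypothesis phi_id : forall k x, phi k k x = x.
Hypothesis c0 : forall j k, 0 < c j k.
Hypothesis c_comp : forall j k l, c j k * c k l = c j l.
Hypothesis mu_phi : forall j k E, measurable E ->
  mu (phi j k @^-1` E) = ((c j k)%:E * mu E)%E.
Local Notation cLfunT := (cLfunType mu mD p1).
Local Notation X := (cLspace mu mD p1).
Local Open Scope quotient_scope.

Let p_gt0 : 0 < p. Proof. exact: lt_le_trans ltr01 p1. Qed.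

Let w j k : R := c j k `^ (- p^-1).

Let w_comp j k l : w j k * w k l = w j l.
Proof. by rewrite /w -powRM ?(ltW (c0 _ _))// c_comp. Qed.

Let c_id k : c k k = 1.
Proof.
have ckk : c k k != 0 by rewrite gt_eqF.
by apply: (mulfI ckk); rewrite c_comp mulr1.
Qed.

Let wc j k : w j k `^ p * c j k = 1.
Proof.
rewrite /w -powRrM mulNr mulVf ?gt_eqF// powR_inv1 ?(ltW (c0 _ _))//.
by rewrite mulVf// gt_eqF.
Qed.

Let phiAD j k : phi j k @^-1` (A k) `<=` D.
Proof. by rewrite phiA. Qed.

Let W j k : cLfunT -> cLfunT :=
  cLfun_wcomp (mA k) (@AD k) (@phiAD j k) (mphi j k) (ltW (c0 j k))
    (powR_ge0 _ _) (wc j k) (@mu_phi j k).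

Let WE j k f x : W j k f x =
  if x \in A j then (w j k)%:C * f (phi j k x) else 0.
Proof.
by rewrite -[LHS]/(wcomp (A k) (phi j k) (w j k) f x) /wcomp phiA.
Qed.

Let WkkE k f x : W k k f x = if x \in A k then f x else 0.
Proof. by rewrite WE phi_id /w c_id powR1 mul1r. Qed.

Let W_mul j k l m f : W j k (W l m f) = (k == l)%:R *: W j m f.
Proof.
apply: val_inj; apply/funext => x.
rewrite -[LHS]/(W j k (W l m f) x) -[RHS]/((k == l)%:R * W j m f x) !WE.
case: ifPn => [|_]; last by rewrite mulr0.
rewrite inE => Ajx; have Akx : A k (phi j k x) by rewrite -(phiA j k) in Ajx.
have [<-|kl] := eqVneq k l.
  by rewrite mem_set// mul1r phi_comp mulrA -rmorphM/= w_comp.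
rewrite ifF ?mulr0 ?mul0r//; apply/negP; rewrite inE => Alx.
by move/eqP : kl; apply; apply: (tA Logic.I Logic.I); exists (phi j k x).
Qed.

Let sumW_in k n f x : A k x -> (k < n)%N ->
  (\sum_(0 <= i < n) W i i f : cLfunT) x = f x.
Proof.
move=> Akx kn; rewrite cLfun_val_sum big_mkord.
under eq_bigr do rewrite WkkE.
rewrite (bigD1 (Ordinal kn))//= mem_set// big1 ?addr0// => i ik; rewrite ifF//.
apply/negP; rewrite inE => Aix; move/negP : ik; apply; apply/eqP/val_inj => /=.
by apply: (tA Logic.I Logic.I); exists x.
Qed.

Let sumW_out n f x : (forall k, (k < n)%N -> ~ A k x) ->
  (\sum_(0 <= i < n) W i i f : cLfunT) x = 0.
Proof.
move=> An; rewrite cLfun_val_sum big_mkord big1// => i _.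
by rewrite WkkE ifF//; apply/negP; rewrite inE; exact: An.
Qed.

Let cLnorm_sumW (f : cLfunT) e : 0 < e -> \forall n \near \oo,
  (cLnorm mu D p ((f - \sum_(0 <= i < n) W i i f)%R : cLfunT) <= e%:E)%E.
Proof.
apply: (cLnorm_dominated mD p1 _ (cLfun_valP f)).
- by move=> n; exact: cLfun_measurable.
- move=> n x Dx; rewrite -[(_ - _ : cLfunT) x]/
    (f x - (\sum_(0 <= i < n) W i i f : cLfunT) x).
  have [[k kn Akx]|nA] := pselect (exists2 k, (k < n)%N & A k x).
    by rewrite (sumW_in _ Akx)// subrr normc0 normc_ge0.
  by rewrite sumW_out ?subr0// => k kn Akx; apply: nA; exists k.
apply: filterS coverA => x /[apply] -[k Akx]; near=> n.
rewrite -[LHS]/(f x - (\sum_(0 <= i < n) W i i f : cLfunT) x).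
rewrite (sumW_in _ Akx) ?subrr//; near: n; exact: nbhs_infty_gt.
Unshelve. all: by end_near. Qed.

(** Both the matrix relations and the action of the diagonal units are checked
    on representatives, where they hold pointwise.  The second clause records
    that the range of [u 0 0] contains the functions supported on [A 0]. *)
Lemma dilation_matrix_units : exists2 u : nat -> nat -> {linear X -> X},
  matrix_units u & forall f : cLfunT, (forall x, D x -> ~ A 0%N x -> f x = 0) ->
    u 0%N 0%N (\pi_X f) = \pi_X f.
Proof.
have exU j k : exists U : {linear X -> X},
    (forall f, U (\pi_X f) = \pi_X (W j k f)) /\ forall u, `|U u| <= `|u|.
  have [|f|U UE cU] := @lift_contraction _ _ _ mu D mD p p1 (W j k).
  - exact: cLfun_wcomp_linear.
  - apply: (le_cLnorm_wcomp mD p1 (mA k) (@AD k) (@phiAD j k) (mphi j k)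
      (ltW (c0 j k)) (powR_ge0 _ _) (wc j k) (@mu_phi j k)).
    exact: cLfun_measurable.
  by exists U.
pose u j k := projT1 (cid (exU j k)).
have uE j k f : u j k (\pi_X f) = \pi_X (W j k f).
  by rewrite /u; case: cid => /= U [].
have u1 j k x : `|u j k x| <= `|x|.
  by rewrite /u; case: cid => /= U [].
exists u; last first.
  move=> f fA; rewrite uE; apply/cLspace_eqP; apply/aeW => x Dx.
  rewrite WkkE; case: ifPn => //; rewrite notin_setE => nA.
  by rewrite fA.
split.
- by move=> j k; exact: contraction_bounded (u1 j k).
- apply: (@le_lt_trans _ _ 1%:E); last exact: ltry.
  apply: ge_ereal_sup => _ [[j k] _ <-].
  exact: contraction_operator_norm (u1 j k).
- move=> j k l m; elim/quotW => f.
  by rewrite (uE l m f) (uE j k) (uE j m f) W_mul pi_cLspaceZ.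
elim/quotW => f; apply/cvgrPdist_lt => e /gt0_complexE[-> e0].
have e20 : 0 < complex.Re e / 2 by rewrite divr_gt0.
apply: filterS (cLnorm_sumW f e20) => n Nn.
have -> : series (fun k => u k k (\pi_X f)) n =
    \pi_X (\sum_(0 <= i < n) W i i f) :> X.
  by rewrite pi_cLspace_sum; apply: eq_bigr => i _; exact: uE.
rewrite -pi_cLspaceB norm_pi_cLspace ltcR.
rewrite -(fineK (cLfun_fin_num _)) lee_fin in Nn.
by apply: le_lt_trans Nn _; lra.
Qed.

End dilation_matrix_units.

(** * Infinite dimension *)

Section finite_dimensional_criterion.
Context (R : realType) (X : normedModType R[i]).

(** [n] vectors cannot span [n + 1] independent ones: a nonzero row in the
    kernel of the matrix of their coordinates would give a dependence
    relation. *)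
Lemma not_finite_dimensional (V : set X) (e : nat -> X) :
  (forall i, V (e i)) ->
  (forall n (c : 'I_n -> R[i]), \sum_(i < n) c i *: e i = 0 ->
    forall i, c i = 0) ->
  ~ finite_dimensional V.
Proof.
move=> Ve free_e [n [b VE]].
have /choice[M ME] : forall i : 'I_n.+1, exists c : 'I_n -> R[i],
    \sum_(j < n) c j *: b j = e i.
  by move=> i; have := Ve i; rewrite VE => -[c _ <-]; exists c.
pose A : 'M[R[i]]_(n.+1, n) := \matrix_(i, j) M i j.
have /rowV0Pn[v /sub_kermxP vA /eqP vn0] : kermx A != 0.
  by rewrite -mxrank_eq0 mxrank_ker -lt0n subn_gt0 ltnS rank_leq_col.
apply: vn0; apply/rowP => i; rewrite mxE.
apply: (free_e n.+1 (v 0)).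
under eq_bigr do rewrite -ME scaler_sumr.
rewrite exchange_big/= big1// => j _.
under eq_bigr do rewrite scalerA.
rewrite -scaler_suml; have := congr1 (fun B : 'rV_n => B 0 j) vA.
rewrite !mxE => vAj; rewrite -[RHS](scale0r (b j)); congr (_ *: _).
by rewrite -[RHS]vAj; apply: eq_bigr => k _; rewrite mxE.
Qed.

End finite_dimensional_criterion.

Section indicators.
Context d (T : measurableType d) (R : realType).
Variables (mu : {measure set T -> \bar R}) (D : set T) (mD : measurable D).
Variables (p : R) (p1 : 1 <= p).
Variable J : nat -> set T.
Hypotheses (mJ : forall i, measurable (J i)) (JD : forall i, J i `<=` D).
Hypotheses (tJ : trivIset [set: nat] J).
Hypotheses (J_gt0 : forall i, (0 < mu (J i))%E).
Hypotheses (J_fin : forall i, (mu (J i) < +oo)%E).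
Local Notation cLfunT := (cLfunType mu mD p1).
Local Notation X := (cLspace mu mD p1).
Local Open Scope quotient_scope.

Let p_gt0 : 0 < p. Proof. exact: lt_le_trans ltr01 p1. Qed.

Let ind i (x : T) : R[i] := (\1_(J i) x : R)%:C.

Let ind_cLfun i : ind i \in cLfun mu D p.
Proof.
apply/cLfunP; split.
  split; last exact: measurable_cst.
  by apply: measurable_funTS; exact: measurable_indic.
apply: poweR_lty; rewrite -[ltLHS]/(\int[mu]_(x in D) normp p (ind i) x)%E.
rewrite (eq_integral (fun x => (\1_(J i) x)%:E)); last first.
  move=> x _; rewrite /normp /= expr0n addr0 sqrtr_sqr indicE.
  by case: (_ \in _); rewrite ?normr1 ?powR1// normr0 powR0// gt_eqF.
by rewrite integral_indic// setIidl.
Qed.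

(** If a combination of the indicators vanishes almost everywhere, its
    coefficient on [J k] must be 0, as otherwise [J k] would be null. *)
Lemma disjoint_indicators_free : exists2 e : nat -> cLfunT,
  (forall i x, ~ J i x -> e i x = 0) &
  forall n (c : 'I_n -> R[i]), \sum_(i < n) c i *: (\pi_X (e i) : X) = 0 ->
    forall i, c i = 0.
Proof.
pose e i : cLfunT := CLfun mD p1 (ind_cLfun i).
have eE i x : e i x = ind i x by [].
exists e => [i x nJ|n c].
  by rewrite eE /ind indicE memNset.
have -> : \sum_(i < n) c i *: (\pi_X (e i) : X) =
    \pi_X (\sum_(i < n) c i *: e i).
  elim/big_rec2: _ => [//|i y x _ ->].
  by rewrite pi_cLspaceD pi_cLspaceZ.
move=> /cLspace_eqP sum0 k; apply/eqP/negPn/negP => ck.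
have valsum x :
    (\sum_(i < n) c i *: e i : cLfunT) x = \sum_(i < n) c i * ind i x.
  by elim/big_rec2: _ => [//|i y1 y2 _ <-].
suff : mu (J k) = 0 by move=> Jk0; have := J_gt0 k; rewrite Jk0 ltxx.
case: sum0 => N [mN N0 subN]; apply/eqP; rewrite -measure_le0 -N0.
apply: le_measure; rewrite ?inE// => x Jx; apply: subN => /= /(_ (JD Jx)).
rewrite valsum (bigD1 k)//= big1 => [|i ik].
  rewrite /ind indicE mem_set// addr0 mulr1 => c0.
  by move: ck; rewrite c0 => /eqP; apply.
rewrite /ind indicE memNset ?mulr0// => Jix; move/negP: ik; apply.
by apply/eqP/val_inj/(tJ Logic.I Logic.I); exists x.
Qed.

End indicators.

(** * Dyadic intervals *)

Section dyadic.
Context (R : realType).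

Lemma trivIset_oc (a : nat -> R) :
  {homo a : m n / (m <= n)%N >-> n <= m} ->
  trivIset [set: nat] (fun k => `]a k.+1, a k]%classic).
Proof.
move=> a_ni; suff lt i j x : (i < j)%N -> `]a i.+1, a i]%classic x ->
    ~ `]a j.+1, a j]%classic x.
  by move=> i j _ _ [x [xi xj]]; case: (ltngtP i j) => // ij;
    [case: (lt _ _ _ ij xi xj)|case: (lt _ _ _ ij xj xi)].
move=> ij /=; rewrite !in_itv/= => /andP[ax _] /andP[_ xa].
by have := le_lt_trans (le_trans xa (a_ni _ _ ij)) ax; rewrite ltxx.
Qed.

Lemma exprn_half_ni :
  {homo (fun n => 2^-1 ^+ n : R) : m n / (m <= n)%N >-> n <= m}.
Proof. by move=> m n mn; rewrite ler_wiXn2l// invf_le1// ler1n. Qed.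

Lemma dyadic_cover (x : R) : 0 < x <= 1 ->
  exists k, `]2^-1 ^+ k.+1, 2^-1 ^+ k]%classic x.
Proof.
move=> /andP[x0 x1]; have exk : exists k, 2^-1 ^+ k.+1 < x.
  have [n nx] := exprn_half_lt x0; exists n.
  by apply: le_lt_trans nx; exact: exprn_half_ni.
exists (ex_minn exk); case: ex_minnP => k kx kmin /=; rewrite in_itv/= kx/=.
case: k => [|k] in kx kmin *; first by rewrite expr0.
by rewrite leNgt; apply/negP => /kmin; rewrite ltnn.
Qed.

Lemma dyadic_sub_unit k :
  `]2^-1 ^+ k.+1, 2^-1 ^+ k]%classic `<=` (`[0, 1]%classic : set R).
Proof.
move=> x /=; rewrite !in_itv/= => /andP[kx xk]; apply/andP; split.
  by rewrite (le_trans _ (ltW kx))// exprn_ge0.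
by rewrite (le_trans xk)// exprn_ile1 ?invf_le1 ?ler1n.
Qed.

(** The dyadic intervals under x |-> (1 + x) / 2, which maps ]0, 1] onto the
    dyadic interval ]1/2, 1]. *)
Lemma shifted_dyadic_sub k :
  `](1 + 2^-1 ^+ k.+1) / 2, (1 + 2^-1 ^+ k) / 2]%classic `<=`
  (`]2^-1 ^+ 1, 2^-1 ^+ 0]%classic : set R).
Proof.
move=> x /=; rewrite !in_itv/= expr1 expr0 => /andP[kx xk].
have hk1 : 2^-1 ^+ k <= 1 :> R by rewrite exprn_ile1 ?invf_le1 ?ler1n.
have hk0 : 0 < 2^-1 ^+ k.+1 :> R by rewrite exprn_gt0.
by apply/andP; split; lra.
Qed.

End dyadic.

(** * The space L^p[0,1] *)

Local Open Scope quotient_scope.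

(** The dilation carrying the [j]-th dyadic interval onto the [k]-th one is the
    multiplication by [2^-1 ^+ k / 2^-1 ^+ j]. *)
Lemma dyadic_matrix_units (R : realType) (p : R) (p1 : 1 <= p) :
  exists2 u : nat -> nat -> {linear Lp01 p1 -> Lp01 p1}, matrix_units u &
  forall f : cLfunType completed_lebesgue_measure
      (@measurable_unit_interval R) p1,
    (forall x, `[0%R, 1%R]%classic x ->
      ~ (`]2^-1 ^+ 1, 2^-1 ^+ 0]%classic : set R) x -> f x = 0) ->
    u 0%N 0%N (\pi_(Lp01 p1) f) = \pi_(Lp01 p1) f.
Proof.
pose mu := @completed_lebesgue_measure R.
pose r k : R := 2^-1 ^+ k.
pose A k : set (lebesgue_type R) := `]r k.+1, r k]%classic.
have r0 k : 0 < r k by rewrite exprn_gt0.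
have rn0 k : r k != 0 by rewrite gt_eqF.
pose phi j k (x : lebesgue_type R) : lebesgue_type R := (r k / r j * x : R).
have phi0 j k : 0 < r k / r j by rewrite divr_gt0.
have mA k : measurable (A k) by exact: measurable_oc.
have A01 k : A k `<=` (`[0%R, 1%R]%classic : set (lebesgue_type R)).
  exact: dyadic_sub_unit.
have tA : trivIset [set: nat] A := trivIset_oc (@exprn_half_ni R).
have coverA : {ae mu, forall x,
    (`[0%R, 1%R]%classic : set (lebesgue_type R)) x -> exists k, A k x}.
  exists [set (0 : R)]; split.
  - by apply: sub_caratheodory; exact: (@measurable_set1 _ (0 : R)).
  - exact: (@lebesgue_measure_set1 R 0).
  move=> x /= nx; apply: contrapT => xn0; apply: nx.
  rewrite in_itv/= => /andP[x0 x1]; apply: dyadic_cover.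
  by rewrite x1 andbT lt_neqAle x0 andbT eq_sym; exact/eqP.
have mphi j k : measurable_fun [set: lebesgue_type R] (phi j k).
  exact: measurable_dil.
have phiA j k : phi j k @^-1` (A k) = A j.
  rewrite [LHS](preimage_dil_oc _ _ (phi0 j k)) invf_div /A /r !exprS.
  by rewrite mulrCA (divfK (rn0 k)).
apply: (@dilation_matrix_units _ _ R mu _ (@measurable_unit_interval R) p p1
  A phi (fun j k => r j / r k) mA A01 tA coverA mphi phiA).
- by move=> j k l x; rewrite /phi; field; rewrite ?rn0.
- by move=> k x; rewrite /phi divff// mul1r.
- by move=> j k; exact: phi0.
- by move=> j k l; field; rewrite ?rn0.
move=> j k E _; rewrite -[in RHS]invf_div.
exact: completed_lebesgue_measure_dil.
Qed.

Theorem proposition3p7 (R : realType) (p : R) (p1 : 1 <= p) :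
  uniform_multiplicity_infinity_infinite_index (Lp01 p1).
Proof.
have [u unitu u00] := dyadic_matrix_units p1.
(* the intervals [J k] cut the first dyadic piece ]1/2, 1] dyadically *)
pose a k : R := (1 + 2^-1 ^+ k) / 2.
have a_lt k : a k.+1 < a k.
  have hk : 0 < 2^-1 ^+ k :> R by rewrite exprn_gt0.
  by rewrite /a ltr_pM2r// ltrD2l exprS; lra.
pose J k : set (lebesgue_type R) := `]a k.+1, a k]%classic.
have mJ k : measurable (J k) by exact: measurable_oc.
have JD k : J k `<=` (`[0%R, 1%R]%classic : set (lebesgue_type R)).
  by move=> x /shifted_dyadic_sub; exact: (@dyadic_sub_unit R 0).
have muJ k : completed_lebesgue_measure (J k) = (a k - a k.+1)%:E.
  by apply: completed_lebesgue_measure_oc; exact: ltW.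
have tJ : trivIset [set: nat] J.
  apply: trivIset_oc => m n mn; rewrite ler_pM2r// lerD2l.
  exact: exprn_half_ni.
have [||e eJ free_e] := @disjoint_indicators_free _ _ R
  completed_lebesgue_measure _ (@measurable_unit_interval R) p p1 J mJ JD tJ.
- by move=> k; rewrite [ltRHS](muJ k) lte_fin subr_gt0.
- by move=> k; rewrite [ltLHS](muJ k) ltry.
pose v i : Lp01 p1 := \pi_(Lp01 p1) (e i).
split.
- exact: cLspace_complete.
- exact: (@not_finite_dimensional _ _ _ v _ free_e).
exists u => //; apply: (@not_finite_dimensional _ _ _ v _ free_e) => i.
exists (v i) => //.
by apply: u00 => x _ nA; apply: eJ => /shifted_dyadic_sub.
Qed.
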